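(* Let $p\in[1,\infty)$, let $(\Omega, \mu)$ be a finite measure space and let $(\{f_\alpha\}_{\alpha\in \Omega}, \{\tau_\alpha\}_{\alpha\in \Omega})$ be a continuous $p$-Bessel family for a real Banach space $\mathcal{X}$, with continuous analysis operator $\theta_f$ and continuous synthesis operator $\theta_\tau$, satisfying the following: (i) $f_\alpha(\tau_\alpha)=1$ for all $\alpha \in \Omega$; (ii) $\|f_\alpha\|\leq 1$ and $\|\tau_\alpha\|\leq 1$ for all $\alpha \in \Omega$; (iii) $\theta_f \theta_\tau \chi_\Omega \geq 0$, where $\chi_\Omega$ is the constant function $1$ on $\Omega$. If the diagonal $\Delta:= \{(\alpha, \alpha):\alpha \in \Omega\}$ is measurable in the measure space $\Omega\times \Omega$, then $$\sup_{\alpha, \beta \in \Omega,\ \alpha\neq \beta}f_\alpha(\tau_\beta) \geq \frac{-(\mu\times\mu)(\Delta)}{(\mu\times\mu)((\Omega\times\Omega)\setminus\Delta)}.$$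
   Context: $\mu\times\mu$ denotes the product measure on $\Omega\times\Omega$, and $\mathcal{X}^*$ denotes the dual of $\mathcal{X}$. Let $(\Omega,\mu)$ be a measure space and $p\in[1,\infty)$. Let $\{\tau_\alpha\}_{\alpha\in\Omega}$ be a collection in a real Banach space $\mathcal{X}$ and $\{f_\alpha\}_{\alpha\in\Omega}$ a collection in $\mathcal{X}^*$. The pair $(\{f_\alpha\}_{\alpha\in\Omega},\{\tau_\alpha\}_{\alpha\in\Omega})$ is called a continuous $p$-Bessel family for $\mathcal{X}$ if: (a) for each $x\in\mathcal{X}$, the map $\Omega\ni\alpha\mapsto f_\alpha(x)\in\mathbb{R}$ is measurable; (b) for each $u\in\mathcal{L}^p(\Omega,\mu)$, the map $\Omega\ni\alpha\mapsto u(\alpha)\tau_\alpha\in\mathcal{X}$ is measurable; (c) the continuous analysis operator $\theta_f:\mathcal{X}\to\mathcal{L}^p(\Omega,\mu)$, $(\theta_f x)(\alpha):=f_\alpha(x)$, is a well-defined bounded linear operator; (d) the continuous synthesis operator $\theta_\tau:\mathcal{L}^p(\Omega,\mu)\to\mathcal{X}$, $\theta_\tau u:=\int_\Omega u(\alpha)\tau_\alpha\,d\mu(\alpha)$, is a well-defined bounded linear operator. (Integrals of vector-valued functions are weak, i.e. Pettis, integrals.) The inequality $\theta_f\theta_\tau\chi_\Omega\geq 0$ is an inequality between elements of $\mathcal{L}^p(\Omega,\mu)$. *)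

(* Defs.v *)
From HB Require Import structures.
From mathcomp Require Import all_boot all_order all_algebra.
From mathcomp Require Import all_classical all_reals all_analysis.

Set Implicit Arguments.
Unset Strict Implicit.
Unset Printing Implicit Defensive.

Import Order.TTheory GRing.Theory Num.Theory.
Import numFieldNormedType.Exports.

Local Open Scope classical_set_scope.
Local Open Scope ring_scope.

Section dual_pettis.
Context {R : realType} {X : normedModType R}.

(* Elements of the dual are handled unbundled: a linear form [phi] together
   with a proof of [continuous phi].  [dual_norm phi] is the operator norm; the
   set below is non-empty, and it is bounded when [phi] is continuous. *)
Definition dual_norm (phi : {linear X -> R^o}) : R :=
  sup [set `|phi x| | x in [set x : X | `|x| <= 1]].

Definition borel_type : measurableType _ := g_sigma_algebraType (@open X).

Context {d : measure_display} {T : measurableType d}.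
Variable mu : {measure set T -> \bar R}.

Definition is_pettis_integral (E : set T) (g : T -> X) (v : X) : Prop :=
  forall phi : {linear X -> R^o}, continuous phi ->
    mu.-integrable E (fun a => (phi (g a))%:E) /\
    (phi v)%:E = (\int[mu]_(a in E) (phi (g a))%:E)%E.

Definition pettis_integrable (g : T -> X) : Prop :=
  forall E, measurable E -> exists v, is_pettis_integral E g v.

(* At most one [v] qualifies, since the dual separates the points of [X]
   (Hahn-Banach); [0] is the junk value for non-integrable functions. *)
Definition pettis_integral (g : T -> X) : X :=
  xget 0 [set v | is_pettis_integral [set: T] g v].

End dual_pettis.

Arguments borel_type {R} X.

Section bessel.
Context {R : realType} {X : normedModType R}.
Context {d : measure_display} {T : measurableType d}.

Definition analysis_op (f : T -> {linear X -> R^o}) : X -> T -> R :=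
  fun x a => f a x.

Definition synthesis_op (mu : {measure set T -> \bar R}) (tau : T -> X) :
    (T -> R) -> X :=
  fun u => pettis_integral mu (fun a => u a *: tau a).

(* Elements of L^p are represented by functions in [Lfun mu p%:E]; both
   operators are compatible with equality almost everywhere (for synthesis, by
   linearity and boundedness with respect to the L^p seminorm). *)
Record continuous_p_bessel (mu : {measure set T -> \bar R}) (p : R)
    (f : T -> {linear X -> R^o}) (tau : T -> X) : Prop :=
  ContinuousPBessel {
    bessel_dual : forall a, continuous (f a);
    bessel_measurable_f :
      forall x, measurable_fun [set: T] (fun a => f a x : R);
    bessel_measurable_tau : forall u, u \in Lfun mu p%:E ->
      measurable_fun [set: T] (fun a => u a *: tau a : borel_type X);
    bessel_analysis_Lp : forall x, analysis_op f x \in Lfun mu p%:E;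
    bessel_analysis_linear : forall (k : R) (x y : X) (a : T),
      analysis_op f (k *: x + y) a = k * analysis_op f x a + analysis_op f y a;
    bessel_analysis_bounded : exists C : R, forall x,
      ('N[mu]_p%:E[EFin \o analysis_op f x] <= (C * `|x|)%:E)%E;
    bessel_synthesis_integrable : forall u, u \in Lfun mu p%:E ->
      pettis_integrable mu (fun a => u a *: tau a);
    bessel_synthesis_linear : forall (k : R) (u v : T -> R),
      u \in Lfun mu p%:E -> v \in Lfun mu p%:E ->
      synthesis_op mu tau (fun a => k * u a + v a) =
      k *: synthesis_op mu tau u + synthesis_op mu tau v;
    bessel_synthesis_bounded : exists C : R, forall u, u \in Lfun mu p%:E ->
      (`|synthesis_op mu tau u|%:E <= C%:E * 'N[mu]_p%:E[EFin \o u])%E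
  }.

End bessel.

(* Main.v *)
(* Integrating [f a v] against [mu] never requires joint measurability of
   [(a, b) |-> f a (tau b)]: for fixed [a] the vector [v = theta_tau chi]
   satisfies [f a v = \int f a (tau b) dmu(b)], which is at most
   [mu {a} + s mu (Omega \ {a})], [s] being the off-diagonal supremum; since
   [0 <= f a v] for almost all [a] and [{a}] is the section of the diagonal,
   integrating over [a] gives [0 <= (mu x mu)(Delta) + s (mu x mu)(Delta^c)]. *)
Require Import Defs.
From mathcomp Require Import all_boot all_order all_algebra.
From mathcomp Require Import all_classical all_reals all_analysis.
Import Order.TTheory GRing.Theory Num.Theory.
Import numFieldNormedType.Exports.

Local Open Scope classical_set_scope.
Local Open Scope ring_scope.

Lemma pettis_integralP (R : realType) (X : normedModType R)
    (d : measure_display) (T : measurableType d)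
    (mu : {measure set T -> \bar R}) (g : T -> X) :
  pettis_integrable mu g ->
  is_pettis_integral mu [set: T] g (pettis_integral mu g).
Proof. by move=> /(_ _ measurableT) ex_v; apply: xgetPex. Qed.

Lemma xsection_diagonal (T : Type) (a : T) : xsection (@diagonal T) a = [set a].
Proof.
by apply/seteqP; split=> b; rewrite /xsection /= inE /diagonal /= => ->.
Qed.

Lemma xsection_setD_diagonal (T : Type) (a : T) :
  xsection ([set: T * T] `\` @diagonal T) a = ~` [set a].
Proof.
rewrite xsectionD xsection_diagonal setDE -[RHS]setTI; congr (_ `&` _).
by apply/seteqP; split=> b //= _; rewrite /xsection /= inE.
Qed.

(** Since [mu] is finite, the constants [r] and [s], of either sign, are integrable on [A] and on
    its complement, so monotonicity of the integral applies on each piece. *)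
Lemma integral_le_split (R : realType) (d : measure_display)
    (T : measurableType d) (mu : {finite_measure set T -> \bar R})
    (A : set T) (g : T -> R) (r s : R) :
  measurable A -> mu.-integrable [set: T] (EFin \o g) ->
  (forall x, A x -> g x <= r) -> (forall x, ~ A x -> g x <= s) ->
  (\int[mu]_x (g x)%:E <= r%:E * mu A + s%:E * mu (~` A))%E.
Proof.
move=> mA ig gr gs; have mAC := measurableC mA.
have mg := measurable_int _ ig.
rewrite -[X in integral _ X](setUv A) integral_setU//; last 2 first.
- by rewrite setUv.
- by rewrite disj_set2E setICr.
have bound B c : measurable B -> (forall x, B x -> g x <= c) ->
    (\int[mu]_(x in B) (g x)%:E <= c%:E * mu B)%E.
  move=> mB gc; rewrite -integral_cst//; apply: le_integral => //.
  - exact: integrableS ig.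
  - exact: finite_measure_integrable_cst.
  - by move=> x /set_mem Bx; rewrite lee_fin gc.
by rewrite leeD// bound.
Qed.

(** By monotonicity the value is at most that of the whole square, which is [mu setT * mu setT]. *)
Lemma product_measure_fin (R : realType) (d : measure_display)
    (T : measurableType d) (mu : {finite_measure set T -> \bar R})
    (A : set (T * T)) :
  measurable A -> (mu \x mu)%E A \is a fin_num.
Proof.
move=> mA; rewrite ge0_fin_numE//.
apply: (@le_lt_trans _ _ ((mu \x mu)%E ([set: T] `*` [set: T]))).
  by rewrite setXTT; apply: le_measure; rewrite ?inE.
rewrite product_measure1E// lte_mul_pinfty//.
- by rewrite fin_num_measure.
- by rewrite -ge0_fin_numE// fin_num_measure.
Qed.

Theorem theorem3p2 (R : realType) (X : completeNormedModType R)
    (d : measure_display) (Omega : measurableType d)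
    (mu : {finite_measure set Omega -> \bar R})
    (p : R) (p_ge1 : 1 <= p)
    (f : Omega -> {linear X -> R^o}) (tau : Omega -> X)
    (bessel : continuous_p_bessel mu p f tau)
    (f_tau : forall a, f a (tau a) = 1)
    (f_norm : forall a, dual_norm (f a) <= 1)
    (tau_norm : forall a, `|tau a| <= 1)
    (analysis_synthesis_ge0 :
      {ae mu, forall a, 0 <= analysis_op f (synthesis_op mu tau (cst 1)) a})
    (measurable_diagonal : measurable (@diagonal Omega))
    (quotient_defined :
      ~ ((mu \x mu)%E (@diagonal Omega) = 0%E /\
         (mu \x mu)%E ([set: Omega * Omega] `\` @diagonal Omega) = 0%E)) :
  ((- (mu \x mu) (@diagonal Omega))
     / (mu \x mu) ([set: Omega * Omega] `\` @diagonal Omega)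
   <= ereal_sup [set (f ab.1 (tau ab.2))%:E
                | ab in [set ab : Omega * Omega | ab.1 <> ab.2]])%E.

Proof.
set offdiag := [set: Omega * Omega] `\` @diagonal Omega.
set s := ereal_sup _.
have m_off : measurable offdiag by exact: measurableD.
(* Singletons are measurable because they are the sections of the diagonal. *)
have m1 (a : Omega) : measurable [set a].
  by rewrite -xsection_diagonal; exact: measurable_xsection.
have le_s a b : a <> b -> ((f a (tau b))%:E <= s)%E.
  by move=> ab; apply: ereal_sup_ubound; exists (a, b).
have [off0|off_neq0] := eqVneq ((mu \x mu)%E offdiag) 0%E.
  (* In [\bar R], [0^-1 = +oo], so the quotient is [-oo]. *)
  rewrite off0 inve0 lt0_muley ?leNye// oppe_lt0 lt0e measure_ge0 andbT.
  by apply/eqP => diag0; exact: quotient_defined.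
have off_gt0 : (0 < (mu \x mu)%E offdiag)%E by rewrite lt0e off_neq0 measure_ge0.
(* The quotient is never positive, so only [s < 0] needs an argument. *)
have [s_ge0|s_lt0] := leP 0%E s.
  apply: le_trans s_ge0; rewrite mulNe oppe_le0 mule_ge0// inve_ge0.
  exact: measure_ge0.
(* The value [+oo] contradicts [s < 0]. The value [-oo] would require that there be no off-diagonal
   pair, but a set of nonzero measure has a point. *)
have [r r_s] : exists r : R, s = r%:E.
  case: s le_s s_lt0 => [r _ _|//|le_s _]; first by exists r.
  have [[a b] [_ ab_neq]] : exists ab, offdiag ab.
    apply/set0P; apply: contraNN off_neq0 => /eqP ->; exact/eqP/measure0.
  by have := le_s _ _ ab_neq; rewrite leeNy_eq.
have r_lt0 : r < 0 by rewrite -lte_fin -r_s.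
have Nr_ge0 : (0 <= (- r)%:E)%E by rewrite lee_fin oppr_ge0 ltW.
pose v := synthesis_op mu tau (cst 1).
have v_pettis : is_pettis_integral mu [set: Omega] (fun b => 1 *: tau b) v.
  apply: pettis_integralP; apply: (bessel_synthesis_integrable bessel).
  exact: Lfun_cst.
have fv_le a : ((f a v)%:E <= mu [set a] + r%:E * mu (~` [set a]))%E.
  have [ifa ->] := v_pettis (f a) (@bessel_dual _ _ _ _ _ _ _ _ bessel a).
  (* The coefficient 1 of [mu [set a]] is the value [f a (tau a)]; away from [a] the integrand is at
     most the supremum [r]. *)
  rewrite -[X in (_ <= X + _)%E]mul1e; apply: integral_le_split => //.
    by move=> b ->; rewrite scale1r f_tau.
  by move=> b /= ba; rewrite scale1r -lee_fin -r_s le_s// => /esym.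
have off_le_diag :
    ((- r)%:E * (mu \x mu) offdiag <= (mu \x mu) (@diagonal Omega))%E.
  (* With the factor [- r >= 0], both sides are integrals of nonnegative functions of [a], so an
     almost everywhere comparison of sections suffices. *)
  rewrite /product_measure1 -ge0_integralZl//=; last first.
    exact: measurable_fun_xsection.
  apply: ae_ge0_le_integral => //=.
  - by move=> a _; rewrite mule_ge0.
  - by apply: measurable_funeM; exact: measurable_fun_xsection.
  - exact: measurable_fun_xsection.
  apply: filterS analysis_synthesis_ge0 => a fv_ge0 _.
  rewrite xsection_diagonal xsection_setD_diagonal EFinN mulNe.
  have := @le_trans _ _ _ 0%E _ _ (fv_le a); rewrite lee_fin => /(_ fv_ge0).
  by rewrite -leeBlDr ?sub0e// fin_numM// fin_num_measure//; exact: measurableC.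
have off_fin := product_measure_fin _ _ _ mu _ m_off.
(* The off-diagonal measure is positive and finite, so the extended quotient is division by a
   positive real. *)
rewrite r_s -(fineK off_fin) inver gt_eqF ?fine_gt0 ?off_gt0 ?ltey_eq ?off_fin//.
rewrite lee_pdivrMr ?fine_gt0 ?off_gt0 ?ltey_eq ?off_fin// fineK//.
by rewrite leeNl -mulNe -EFinN.
Qed.
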